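(* Let $\lambda_1\in\mathbb{R}$ with $0<|\lambda_1|<1$ and $h\in\mathbb{R}_{>0}$. Consider the instance of the priori (resp., posteriori) KFSS problem with $W=I_3$, $V=\mathbf{0}_{3\times 3}$, $$A=\begin{bmatrix}\lambda_1&0&0\\0&0&0\\0&0&0\end{bmatrix},\qquad C=\begin{bmatrix}1&h&h\\1&0&h\\0&1&1\end{bmatrix},$$ candidate sensors $\mathcal{Q}=\{1,2,3\}$ where sensor $i$ corresponds to the $i$th row of $C$, selection costs $b=[1\ 1\ 1]^T$ and budget $B=2$. Let $\Sigma_{gre}$ (resp., $\Sigma^*_{gre}$) be the steady state a priori (resp., a posteriori) error covariance for the sensors selected by the greedy algorithm for the priori (resp., posteriori) problem, and let $\Sigma_{opt}$ (resp., $\Sigma^*_{opt}$) be that of an optimal selection. Then the ratios $r_{gre}(\Sigma)=\frac{\mathrm{trace}(\Sigma_{gre})}{\mathrm{trace}(\Sigma_{opt})}$ and $r_{gre}(\Sigma^* )=\frac{\mathrm{trace}(\Sigma^*_{gre})}{\mathrm{trace}(\Sigma^*_{opt})}$ satisfy $$\lim_{h\to\infty}r_{gre}(\Sigma)=\frac23+\frac{1}{3(1-\lambda_1^2)}\qquad\text{and}\qquad \lim_{h\to\infty}r_{gre}(\Sigma^* )=\frac{1}{1-\lambda_1^2},$$ respectively.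
   Context: System model. Consider $x[k+1]=Ax[k]+w[k]$, $x[k]\in\mathbb{R}^n$, with $w[k]$ zero-mean white Gaussian noise of covariance $W$, and sensors $i\in\mathcal{Q}=\{1,\dots,q\}$ with scalar measurements $y_i[k]=C_ix[k]+v_i[k]$, where $C_i$ is the $i$th row of $C$ and the stacked noise $v[k]$ is zero-mean white Gaussian with covariance $V$, uncorrelated with $w$. The initial state is Gaussian, independent of the noises, with mean $\mathbf{0}$ and covariance $\Pi_0=I_n$. For a set $\mathcal{S}\subseteq\mathcal{Q}$ of sensors (equivalently its indicator vector $\mu$), $C(\mathcal{S})$ and $V(\mathcal{S})$ are the stacked measurement matrix and noise covariance of the sensors in $\mathcal{S}$. The Kalman filter error covariances are given by $\Sigma_{0|-1}=\Pi_0$, $\Sigma_{k|k}=\Sigma_{k|k-1}-\Sigma_{k|k-1}C(\mathcal{S})^T(C(\mathcal{S})\Sigma_{k|k-1}C(\mathcal{S})^T+V(\mathcal{S}))^{-1}C(\mathcal{S})\Sigma_{k|k-1}$, $\Sigma_{k+1|k}=A\Sigma_{k|k}A^T+W$ (pseudo-inverse if singular). The steady state a priori and a posteriori error covariances are $\Sigma(\mathcal{S})=\lim_k\Sigma_{k|k-1}$ and $\Sigma^*(\mathcal{S})=\lim_k\Sigma_{k|k}$; they satisfy $\Sigma(\mathcal{S})=A\Sigma^*(\mathcal{S})A^T+W$ and $\Sigma^*(\mathcal{S})=\Sigma(\mathcal{S})-\Sigma(\mathcal{S})C(\mathcal{S})^T(C(\mathcal{S})\Sigma(\mathcal{S})C(\mathcal{S})^T+V(\mathcal{S}))^{-1}C(\mathcal{S})\Sigma(\mathcal{S})$.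 With unit costs and integer budget $B$, the priori (resp., posteriori) KFSS problem is to minimize $\mathrm{trace}(\Sigma(\mathcal{S}))$ (resp., $\mathrm{trace}(\Sigma^*(\mathcal{S}))$) over $\mathcal{S}\subseteq\mathcal{Q}$ with $|\mathcal{S}|\le B$. Greedy algorithm: start with $\mathcal{S}=\emptyset$; repeat $B$ times: choose $j\in\arg\min_{i\notin\mathcal{S}}\mathrm{trace}(\Sigma(\mathcal{S}\cup\{i\}))$ (resp., $j\in\arg\min_{i\notin\mathcal{S}}\mathrm{trace}(\Sigma^*(\mathcal{S}\cup\{i\}))$) and set $\mathcal{S}\leftarrow\mathcal{S}\cup\{j\}$. Output $\mathcal{S}$. *)

(* Defs.v *)
From HB Require Import structures.
From mathcomp Require Import all_boot all_order all_algebra.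
From mathcomp Require Import all_classical all_reals all_analysis.

Set Implicit Arguments.
Unset Strict Implicit.
Unset Printing Implicit Defensive.

Import Order.TTheory GRing.Theory Num.Theory.
Import numFieldNormedType.Exports.

Local Open Scope classical_set_scope.
Local Open Scope ring_scope.

Section KalmanFilter.
Context {R : realType}.

Definition penrose m n (M : 'M[R]_(m, n)) (X : 'M[R]_(n, m)) : Prop :=
  [/\ M *m X *m M = M, X *m M *m X = X,
      (M *m X)^T = M *m X & (X *m M)^T = X *m M].

(** The Penrose equations determine X uniquely; see [penrose_uniq] and
    [penrose_ex], so the default 0 is never used. *)
Definition mpinv m n (M : 'M[R]_(m, n)) : 'M[R]_(n, m) :=
  xget 0 [set X | penrose M X].

Definition kf_inv m (M : 'M[R]_m) : 'M[R]_m :=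
  if M \in unitmx then invmx M else mpinv M.

Record kf_system (n q : nat) := KFSystem {
  kfA : 'M[R]_n;
  kfC : 'M[R]_(q, n);
  kfW : 'M[R]_n;
  kfV : 'M[R]_q }.

Variables (n q : nat) (sys : kf_system n q) (S : {set 'I_q}).

Definition selC : 'M[R]_(#|S|, n) := rowsub enum_val (kfC sys).
Definition selV : 'M[R]_#|S| := mxsub enum_val enum_val (kfV sys).

Definition kf_update (P : 'M[R]_n) : 'M[R]_n :=
  P - P *m selC^T *m kf_inv (selC *m P *m selC^T + selV) *m selC *m P.

(** Sigma_{k|k-1}, with Sigma_{0|-1} = Pi_0 = I_n. *)
Fixpoint prior_cov (k : nat) : 'M[R]_n :=
  if k is k'.+1 then
    kfA sys *m kf_update (prior_cov k') *m (kfA sys)^T + kfW sys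
  else 1%:M.

(** Sigma_{k|k}. *)
Definition post_cov (k : nat) : 'M[R]_n := kf_update (prior_cov k).

Definition prior_ss : 'M[R]_n := lim (prior_cov @ \oo).
Definition post_ss : 'M[R]_n := lim (post_cov @ \oo).

End KalmanFilter.

Section SensorSelection.
Context {R : realType} {q : nat}.
Variable (f : {set 'I_q} -> R).

(** All selection costs are 1, so the cost of S is #|S|. *)
Definition kfss_optimal (B : nat) (S : {set 'I_q}) : Prop :=
  (#|S| <= B)%N /\ (forall T : {set 'I_q}, (#|T| <= B)%N -> f S <= f T).

Definition greedy_choice (S : {set 'I_q}) (j : 'I_q) : Prop :=
  j \notin S /\ (forall i, i \notin S -> f (j |: S) <= f (i |: S)).

(** A relation, since the argmin need not be a singleton: [greedy_output B S]
    holds when some way of breaking ties makes B iterations end in S. *)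
Inductive greedy_output : nat -> {set 'I_q} -> Prop :=
| greedy_output0 : greedy_output 0 (finset.set0)
| greedy_outputS k S j :
    greedy_output k S -> greedy_choice S j -> greedy_output k.+1 (j |: S).

End SensorSelection.

Section Instance.
Context {R : realType}.

Definition mx_of_rows m n (rows : seq (seq R)) : 'M[R]_(m, n) :=
  \matrix_(i, j) (nth [::] rows i)`_j.

Definition exA (lambda1 : R) : 'M[R]_3 := mx_of_rows 3 3
  [:: [:: lambda1; 0; 0];
      [:: 0;       0; 0];
      [:: 0;       0; 0]].

Definition exC (h : R) : 'M[R]_3 := mx_of_rows 3 3
  [:: [:: 1; h; h];
      [:: 1; 0; h];
      [:: 0; 1; 1]].

Definition ex_system (lambda1 h : R) : kf_system 3 3 :=
  KFSystem (exA lambda1) (exC h) 1%:M 0.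

Definition prior_cost (lambda1 h : R) (S : {set 'I_3}) : R :=
  \tr (prior_ss (ex_system lambda1 h) S).

Definition post_cost (lambda1 h : R) (S : {set 'I_3}) : R :=
  \tr (post_ss (ex_system lambda1 h) S).

End Instance.

Section PenroseFacts.
Context {R : realType}.

Lemma penrose_uniq m n (M : 'M[R]_(m, n)) X Y :
  penrose M X -> penrose M Y -> X = Y.
Proof.
move=> [X1 X2 X3 X4] [Y1 Y2 Y3 Y4].
have eMX : M *m X = M *m Y.
  have -> : M *m X = (M *m Y *m (M *m X)).
    by rewrite mulmxA Y1.
  by rewrite -[RHS]Y3 -{1}Y3 -{1}X3 -trmx_mul mulmxA X1.
have eXM : X *m M = Y *m M.
  have -> : X *m M = (X *m M *m (Y *m M)).
    by rewrite -mulmxA (mulmxA M) Y1.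
  by rewrite -{1}Y4 -{1}X4 -trmx_mul -mulmxA (mulmxA M) X1 Y4.
by rewrite -X2 -mulmxA eMX mulmxA eXM Y2.
Qed.

Lemma mulmx_tr_eq0 m n (u : 'M[R]_(m, n)) : u *m u^T = 0 -> u = 0.
Proof.
move=> u0; apply/matrixP => i j; rewrite mxE.
have /eqP : (u *m u^T) i i = 0 by rewrite u0 mxE.
rewrite mxE psumr_eq0; last by move=> k _; rewrite mxE -expr2 sqr_ge0.
by move/allP/(_ j (mem_index_enum j)); rewrite mxE -expr2 sqrf_eq0 => /eqP.
Qed.

Lemma row_free_gram_unit m n (G : 'M[R]_(m, n)) :
  row_free G -> G *m G^T \in unitmx.
Proof.
move=> Gfree; rewrite -row_free_unit; apply/row_freeP.
have : row_free (G *m G^T).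
  rewrite -kermx_eq0; apply/eqP.
  apply: (row_free_inj Gfree); rewrite mul0mx.
  by apply: mulmx_tr_eq0; rewrite trmx_mul mulmxA -(mulmxA (kermx _)) mulmx_ker mul0mx.
by move/row_freeP.
Qed.

Lemma penrose_full_rank_mul m r n (F : 'M[R]_(m, r)) (G : 'M[R]_(r, n)) :
  row_full F -> row_free G -> exists X, penrose (F *m G) X.
Proof.
move=> Ffull Gfree.
have uG : G *m G^T \in unitmx by exact: row_free_gram_unit.
have uF : F^T *m F \in unitmx.
  rewrite -{2}(trmxK F); apply: row_free_gram_unit.
  by rewrite /row_free mxrank_tr -/(row_full F).
pose X := G^T *m invmx (G *m G^T) *m (invmx (F^T *m F) *m F^T).
have eMX : F *m G *m X = F *m invmx (F^T *m F) *m F^T.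
  by rewrite /X -!mulmxA (mulmxA G) (mulmxA (G *m G^T)) mulmxV // mul1mx.
have eXM : X *m (F *m G) = G^T *m invmx (G *m G^T) *m G.
  rewrite /X -!mulmxA (mulmxA F^T) (mulmxA (invmx (F^T *m F))).
  by rewrite mulVmx // mul1mx.
exists X; split.
- rewrite eMX -!mulmxA (mulmxA F^T) (mulmxA (invmx (F^T *m F))).
  by rewrite mulVmx // mul1mx.
- rewrite eXM /X -!mulmxA (mulmxA G G^T) (mulmxA (G *m G^T)) mulmxV //.
  by rewrite mul1mx.
- by rewrite eMX !trmx_mul trmxK trmx_inv trmx_mul trmxK mulmxA.
- by rewrite eXM !trmx_mul trmxK trmx_inv trmx_mul trmxK mulmxA.
Qed.

Lemma penrose_ex m n (M : 'M[R]_(m, n)) : exists X, penrose M X.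
Proof.
rewrite -(mulmx_base M); apply: penrose_full_rank_mul.
  exact: col_base_full.
exact: row_base_free.
Qed.

End PenroseFacts.

(* Main.v *)
Require Import Defs.
From mathcomp Require Import all_boot all_order all_algebra.
From mathcomp Require Import all_classical all_reals all_analysis.
From mathcomp Require Import ring lra.

Import Order.TTheory GRing.Theory Num.Theory.
Import numFieldNormedType.Exports.

Local Open Scope classical_set_scope.
Local Open Scope ring_scope.

(** All prior covariances are of the form [diag (p, 1, 1)].  Except for the pair
    of sensors 1 and 3, observing a set of at most two sensors acts on [p] as
    one scalar measurement: the posterior variance of the first coordinate is
    [p / (1 + g p)], with [g = 0, 1/(2h^2), 1/h^2, 2/h^2] depending on the set,
    and the posterior covariance is affine in this quantity.  The recursion on
    [p] is a contraction; its fixed point [p(g)] is strictly decreasing in [g],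
    so the greedy algorithm starts with sensor 2, and whatever it adds next
    leaves [g <= 2/h^2], hence [p(g)] tends to [p(0) = 1 / (1 - lambda1^2)].
    Sensors 1 and 3 together reveal the first coordinate exactly, which is
    optimal, with costs 3 (a priori) and 1 (a posteriori). *)

(** * Noiseless Kalman updates with a generalized inverse *)

Lemma mulmx_kf_invK (R : realType) m (M : 'M[R]_m) : M *m kf_inv M *m M = M.
Proof.
rewrite /kf_inv; case: ifP => [uM|_]; first by rewrite mulmxV // mul1mx.
by rewrite /mpinv; case: xgetP => [X _ []//|/(_ _) nex]; have [X /nex] := penrose_ex M.
Qed.

(* [L] plays the role of the gain: [kfC *m Q = 0] on [S] forces
   [M *m L = C *m P] for the innovation covariance [M], and [P] being a Gram
   matrix lets the generalized inverse of [M] cancel against it. *)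
Lemma kf_update_noiseless (R : realType) n q (sys : @kf_system R n q)
    (S : {set 'I_q}) (P Q G : 'M[R]_n) (L : 'M[R]_(q, n)) :
  kfV sys = 0 -> P = G *m G^T ->
  (forall i, i \in S -> row i (kfC sys *m Q) = 0) ->
  (forall i, i \notin S -> row i L = 0) ->
  P - Q = P *m (kfC sys)^T *m L ->
  kf_update sys S P = Q.
Proof.
move=> V0 PG CQ L0 PQ; rewrite /kf_update.
have -> : selV sys S = 0 by rewrite /selV V0; apply/matrixP => i j; rewrite !mxE.
rewrite addr0; set C := selC sys S; set M := C *m P *m C^T.
pose LS : 'M[R]_(#|S|, n) := rowsub enum_val L.
have CL : (kfC sys)^T *m L = C^T *m LS.
  apply/matrixP => i j; rewrite !mxE (bigID (mem S)) /= [X in _ + X]big1 ?addr0.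
    by rewrite big_enum_val; apply: eq_bigr => k _; rewrite !mxE.
  by move=> k /L0 /rowP/(_ j); rewrite !mxE => ->; rewrite mulr0.
have CQ0 : C *m Q = 0.
  apply/matrixP => i j.
  have /rowP/(_ j) := CQ _ (enum_valP i); rewrite !mxE => CQij.
  by rewrite -[RHS]CQij; apply: eq_bigr => k _; rewrite !mxE.
have PQS : P - Q = P *m C^T *m LS by rewrite PQ -!mulmxA CL.
have CP : C *m P = M *m LS.
  by rewrite /M -!mulmxA [P *m (_ *m _)]mulmxA -PQS mulmxBr CQ0 subr0.
have MN : M = (C *m G) *m (C *m G)^T by rewrite /M PG trmx_mul !mulmxA.
clearbody M.
(* With N = C G and K = [kf_inv M *m M - 1%:M], M = N N^T, so the Gram matrix of (N^T K)^T is K^T M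
   K, and M K = 0. *)
have gram : (C *m G)^T *m (kf_inv M *m M - 1%:M) = 0.
  apply: (can_inj trmxK); rewrite trmx0; apply: mulmx_tr_eq0.
  rewrite trmxK trmx_mul trmxK -mulmxA [(C *m G) *m _]mulmxA -MN.
  by rewrite mulmxBr mulmx1 mulmxA mulmx_kf_invK subrr mulmx0.
have PM : P *m C^T *m kf_inv M *m M = P *m C^T.
  apply/eqP; rewrite -subr_eq0 -[X in _ - X]mulmx1 -mulmxA -mulmxBr {1}PG.
  by rewrite -[_ *m _ *m C^T]mulmxA -trmx_mul -mulmxA gram mulmx0.
by rewrite -!mulmxA CP !mulmxA PM -PQS opprB addrC subrK.
Qed.

Section Instance3.
Context {R : realType}.
Implicit Types (l h p x u c g : R) (S : {set 'I_3}).

(** * Diagonal prior covariances and convergence to the steady state *)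

Definition diag_cov p : 'M[R]_3 := mx_of_rows 3 3
  [:: [:: p; 0; 0];
      [:: 0; 1; 0];
      [:: 0; 0; 1]].

Lemma diag_covE p : diag_cov p = diag_cov 0 + p *: delta_mx ord0 ord0.
Proof.
apply/matrixP => -[[|[|[|//]]] i3] [[|[|[|//]]] j3]; rewrite !mxE /=; ring.
Qed.

Lemma diag_cov1 : diag_cov 1 = 1%:M.
Proof. by apply/matrixP => -[[|[|[|//]]] i3] [[|[|[|//]]] j3]; rewrite !mxE. Qed.

Lemma diag_cov_gram p : 0 <= p ->
  diag_cov p = diag_cov (Num.sqrt p) *m (diag_cov (Num.sqrt p))^T.
Proof.
move=> p0.
apply/matrixP => -[[|[|[|//]]] i3] [[|[|[|//]]] j3];
  rewrite !mxE !big_ord_recl big_ord0 !mxE /= ?mulr0 ?mul0r ?mulr1 ?addr0 ?add0r //.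
by rewrite -expr2 sqr_sqrtr.
Qed.

(** The only nonzero entry of [exA l] is the top-left one, so prediction keeps a single scalar of
    [Q]; this closes the family [diag_cov] under the recursion. *)
Lemma exA_predict l (Q : 'M[R]_3) :
  exA l *m Q *m (exA l)^T + 1%:M = diag_cov (1 + l ^+ 2 * Q ord0 ord0).
Proof.
apply/matrixP => -[[|[|[|//]]] i3] [[|[|[|//]]] j3];
  rewrite !mxE !big_ord_recl big_ord0 !mxE /= !big_ord_recl !big_ord0 !mxE /=;
  rewrite ?(mulr0, mul0r, addr0, add0r) //.
by rewrite addrC; congr (_ + _); rewrite mulrAC expr2; congr (_ * Q _ _); apply: val_inj.
Qed.

Lemma cvg_affine (V : normedModType R) (v w : V) (s : nat -> R) p :
  s k @[k --> \oo] --> p -> v + s k *: w @[k --> \oo] --> v + p *: w.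
Proof. by move=> cvgs; apply: cvgD; [exact: cvg_cst | exact: cvgZr_tmp]. Qed.

(** Since [u] is 1-Lipschitz on [1, oo), the variance recursion x -> 1 + l^2 u(x) contracts by l^2
    and stays above 1; its iterates converge geometrically to the fixed point [p], and continuity of
    [u] carries this to the posterior. *)
Lemma steady_state l h S (Q0 Q1 : 'M[R]_3) (u : R -> R) p :
  `|l| < 1 -> Q0 ord0 ord0 = 0 -> Q1 ord0 ord0 = 1 ->
  (forall x, 1 <= x ->
     kf_update (ex_system l h) S (diag_cov x) = Q0 + u x *: Q1) ->
  (forall x, 1 <= x -> 0 <= u x) ->
  (forall x y, 1 <= x -> 1 <= y -> `|u x - u y| <= `|x - y|) ->
  1 <= p -> p = 1 + l ^+ 2 * u p ->
  prior_ss (ex_system l h) S = diag_cov p /\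
  post_ss (ex_system l h) S = Q0 + u p *: Q1.
Proof.
move=> l1 Q00 Q10 upd u0 lip p1 fixp.
have a0 : 0 <= l ^+ 2 by rewrite sqr_ge0.
have a1 : `|l ^+ 2| < 1 by rewrite normrX expr_lt1.
pose F x := 1 + l ^+ 2 * u x.
pose s k := iter k F 1.
have s1 k : 1 <= s k.
  by elim: k => [|k IH] //=; rewrite lerDl mulr_ge0 // u0.
have priorE k : prior_cov (ex_system l h) S k = diag_cov (s k).
  elim: k => [|k IH] /=; first by rewrite diag_cov1.
  rewrite IH upd // exA_predict; congr (diag_cov (1 + _ * _)).
  by rewrite !mxE Q00 Q10 add0r mulr1.
have s_dist k : `|p - s k| <= `|p - 1| * (l ^+ 2) ^+ k.
  elim: k => [|k IH]; first by rewrite expr0 mulr1.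
  rewrite /= {1}fixp /F opprD addrACA subrr add0r -mulrBr normrM (ger0_norm a0).
  rewrite [(l ^+ 2) ^+ k.+1]exprS mulrCA ler_wpM2l //; apply: le_trans IH.
  exact: lip.
have cvgs : s k @[k --> \oo] --> p.
  have /cvgr0Pnorm_le := cvg_geometric `|p - 1| a1.
  move=> geo; apply/cvgrPdist_le => e e0; have := geo _ e0.
  apply: filterS => k /=; apply: le_trans.
  by apply: le_trans (s_dist k) _; exact: ler_norm.
have cvgu : u (s k) @[k --> \oo] --> u p.
  move/cvgrPdist_le: cvgs => cvgs; apply/cvgrPdist_le => e e0; have := cvgs _ e0.
  by apply: filterS => k; apply: le_trans; exact: lip.
split; apply: cvg_lim; try exact: norm_hausdorff.
  rewrite (_ : prior_cov _ _ = fun k => diag_cov 0 + s k *: delta_mx ord0 ord0); last first.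
    by apply/funext => k; rewrite priorE diag_covE.
  by rewrite (diag_covE p); exact: (@cvg_affine 'M[R]_3).
rewrite (_ : post_cov _ _ = fun k => Q0 + u (s k) *: Q1); last first.
  by apply/funext => k; rewrite /post_cov priorE upd.
exact: (@cvg_affine 'M[R]_3).
Qed.


(** * Steady costs of each set of sensors *)

Definition sensor1 : 'I_3 := @Ordinal 3 0 isT.
Definition sensor2 : 'I_3 := @Ordinal 3 1 isT.
Definition sensor3 : 'I_3 := @Ordinal 3 2 isT.

Lemma forall_sensor (P : 'I_3 -> Prop) :
  P sensor1 -> P sensor2 -> P sensor3 -> forall i, P i.
Proof.
move=> P1 P2 P3 [[|[|[|//]]] i3].
- by rewrite (_ : Ordinal i3 = sensor1) //; apply: val_inj.
- by rewrite (_ : Ordinal i3 = sensor2) //; apply: val_inj.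
- by rewrite (_ : Ordinal i3 = sensor3) //; apply: val_inj.
Qed.

Lemma ex_update l h S x (Q L : 'M[R]_3) : 0 <= x ->
  (forall i j, if i \in S then (exC h *m Q) i j = 0 else L i j = 0) ->
  (forall i j, (diag_cov x - Q) i j = (diag_cov x *m (exC h)^T *m L) i j) ->
  kf_update (ex_system l h) S (diag_cov x) = Q.
Proof.
move=> x0 CQL PQ; apply: (@kf_update_noiseless _ _ _ _ _ _ _ _ L) => //.
- exact: diag_cov_gram.
- by move=> i iS; apply/rowP => j; have := CQL i j; rewrite iS !mxE.
- by move=> i /negbTE iS; apply/rowP => j; have := CQL i j; rewrite iS !mxE.
- by apply/matrixP.
Qed.

(* [w w^T] for [w = (1, w1, w2)], the regression of the state on its first
   coordinate given the noiseless measurements. *)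
Definition regr_mx (w1 w2 : R) : 'M[R]_3 := mx_of_rows 3 3
  [:: [:: 1;  w1;      w2];
      [:: w1; w1 ^+ 2; w1 * w2];
      [:: w2; w1 * w2; w2 ^+ 2]].

(** Covariance left once the first coordinate is known besides the measurements. *)
Definition residual_mx (a b c : R) : 'M[R]_3 := mx_of_rows 3 3
  [:: [:: 0; 0; 0];
      [:: 0; a; b];
      [:: 0; b; c]].

Definition damp g x := x / (1 + g * x).

Lemma damp_ge0 g x : 0 <= g -> 1 <= x -> 0 <= damp g x.
Proof. by move=> g0 x1; rewrite divr_ge0 ?addr_ge0 ?mulr_ge0 //; lra. Qed.

Lemma damp_lipschitz g x y : 0 <= g -> 1 <= x -> 1 <= y ->
  `|damp g x - damp g y| <= `|x - y|.
Proof.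
move=> g0 x1 y1.
have dx : 1 <= 1 + g * x by nra.
have dy : 1 <= 1 + g * y by nra.
have -> : damp g x - damp g y = (x - y) / ((1 + g * x) * (1 + g * y)).
  by rewrite /damp; field; apply/andP; split; apply: lt0r_neq0; lra.
rewrite normrM ler_piMr // ger0_norm ?invr_ge0 ?invf_le1; nra.
Qed.

(** For g > 0 the equation is quadratic with roots of opposite signs; the bound selects the positive
    one. *)
Definition riccati l g p := 1 <= p /\ p = 1 + l ^+ 2 * damp g p.

Definition has_steady_costs l h S g c :=
  forall p, riccati l g p ->
  prior_cost l h S = p + 2 /\ post_cost l h S = (1 + g) * damp g p + c.

(** The last two coordinates have identity prior covariance, so the information [g] about the first
    one is the squared norm of the regression coefficients, and [regr_mx w1 w2] has trace 1 + g. *)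
Lemma regular_costs l h S w1 w2 a b c g d : `|l| < 1 ->
  g = w1 ^+ 2 + w2 ^+ 2 -> d = a + c ->
  (forall x, 1 <= x -> kf_update (ex_system l h) S (diag_cov x) =
     residual_mx a b c + damp g x *: regr_mx w1 w2) ->
  has_steady_costs l h S g d.
Proof.
move=> l1 gE -> upd p [p1 fixp]; rewrite /prior_cost /post_cost.
have g0 : 0 <= g by rewrite gE addr_ge0 ?sqr_ge0.
have [||||||-> ->] := @steady_state l h S (residual_mx a b c) (regr_mx w1 w2)
  (damp g) p l1 _ _ upd => //.
- by rewrite mxE.
- by rewrite mxE.
- by move=> x; exact: damp_ge0.
- by move=> x y; exact: damp_lipschitz.
by rewrite /mxtrace !big_ord_recl !big_ord0 !mxE /= gE; split; ring.
Qed.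

Ltac positive_neq0 := by repeat (apply/andP; split); try (apply: lt0r_neq0; nra).

(** [L] lists the rows of the transposed gain; rows absent from the list are zero by the defaults of
    [nth]. *)
Ltac check_update S1 S2 S3 L :=
  apply: (@ex_update _ _ _ _ _ (mx_of_rows 3 3 L)); [lra | | ];
  apply: forall_sensor; apply: forall_sensor; rewrite ?S1 ?S2 ?S3;
  rewrite ?(mxE, big_ord_recl, big_ord0) /= /damp;
  first [done | by ring | by field; positive_neq0].

Lemma costs_none l h S : `|l| < 1 ->
  sensor1 \notin S -> sensor2 \notin S -> sensor3 \notin S ->
  has_steady_costs l h S 0 2.
Proof.
move=> l1 /negbTE S1 /negbTE S2 /negbTE S3.
apply: (@regular_costs l h S 0 0 1 0 1) => //; try ring.
move=> x x1.
check_update S1 S2 S3 (@nil (seq R)).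
Qed.

Lemma costs_1 l h S : `|l| < 1 -> 0 < h ->
  sensor1 \in S -> sensor2 \notin S -> sensor3 \notin S ->
  has_steady_costs l h S (2 * h ^+ 2)^-1 1.
Proof.
move=> l1 h0 S1 /negbTE S2 /negbTE S3.
apply: (@regular_costs l h S (- (2 * h)^-1) (- (2 * h)^-1) 2^-1 (- 2^-1) 2^-1) => //.
- by field; positive_neq0.
- by field.
move=> x x1.
check_update S1 S2 S3 [:: [:: x / (x + 2 * h ^+ 2); h / (x + 2 * h ^+ 2);
  h / (x + 2 * h ^+ 2)]].
Qed.

Lemma costs_2 l h S : `|l| < 1 -> 0 < h ->
  sensor1 \notin S -> sensor2 \in S -> sensor3 \notin S ->
  has_steady_costs l h S (h ^+ 2)^-1 1.
Proof.
move=> l1 h0 /negbTE S1 S2 /negbTE S3.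
apply: (@regular_costs l h S 0 (- h^-1) 1 0 0) => //.
- by field; positive_neq0.
- by ring.
move=> x x1.
check_update S1 S2 S3 [:: [::]; [:: x / (x + h ^+ 2); 0; h / (x + h ^+ 2)]].
Qed.

Lemma costs_3 l h S : `|l| < 1 ->
  sensor1 \notin S -> sensor2 \notin S -> sensor3 \in S ->
  has_steady_costs l h S 0 1.
Proof.
move=> l1 /negbTE S1 /negbTE S2 S3.
apply: (@regular_costs l h S 0 0 2^-1 (- 2^-1) 2^-1) => //.
- by ring.
- by field.
move=> x x1.
check_update S1 S2 S3 [:: [::]; [::]; [:: 0 : R; 2^-1; 2^-1]].
Qed.

(** The difference of the two measurements is h times the second coordinate, which carries no
    information on the first; hence the same [g] as for sensor 2 alone. *)
Lemma costs_12 l h S : `|l| < 1 -> 0 < h ->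
  sensor1 \in S -> sensor2 \in S -> sensor3 \notin S ->
  has_steady_costs l h S (h ^+ 2)^-1 0.
Proof.
move=> l1 h0 S1 S2 /negbTE S3.
apply: (@regular_costs l h S 0 (- h^-1) 0 0 0) => //.
- by field; positive_neq0.
- by ring.
move=> x x1.
check_update S1 S2 S3 [:: [:: 0; h^-1; 0];
  [:: x / (x + h ^+ 2); - h^-1; h / (x + h ^+ 2)]].
Qed.

(** Up to known terms, sensor 3 gives x2 = - x3 and sensor 2 gives x3 = - x1 / h, whence the
    coefficients 1/h and -1/h. *)
Lemma costs_23 l h S : `|l| < 1 -> 0 < h ->
  sensor1 \notin S -> sensor2 \in S -> sensor3 \in S ->
  has_steady_costs l h S (2 / h ^+ 2) 0.
Proof.
move=> l1 h0 /negbTE S1 S2 S3.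
apply: (@regular_costs l h S h^-1 (- h^-1) 0 0 0) => //.
- by field; positive_neq0.
- by ring.
move=> x x1.
check_update S1 S2 S3 [:: [::]; [:: 2 * x / (h ^+ 2 + 2 * x);
  - h / (h ^+ 2 + 2 * x); h / (h ^+ 2 + 2 * x)];
  [:: - x * h / (h ^+ 2 + 2 * x); (h ^+ 2 + x) / (h ^+ 2 + 2 * x);
      x / (h ^+ 2 + 2 * x)]].
Qed.

(* Subtracting [h] times the third measurement from the first reveals the
   first state coordinate exactly. *)
Lemma costs_13 l h S : `|l| < 1 ->
  sensor1 \in S -> sensor2 \notin S -> sensor3 \in S ->
  prior_cost l h S = 3 /\ post_cost l h S = 1.
Proof.
move=> l1 S1 /negbTE S2 S3; rewrite /prior_cost /post_cost.
(* The posterior variance of the first coordinate is 0 for every prior, so the fixed point is 1; the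
   residual is that of knowing x2 + x3. *)
have [|||||||-> ->] := @steady_state l h S (residual_mx 2^-1 (- 2^-1) 2^-1)
  (regr_mx 0 0) (fun=> 0) 1 l1 => //.
- by rewrite mxE.
- by rewrite mxE.
- move=> x x1.
  check_update S1 S2 S3 [:: [:: 1; 0; 0]; [::]; [:: - h; 2^-1; 2^-1]].
- by move=> x y _ _; rewrite subrr normr0.
- by rewrite mulr0 addr0.
by rewrite /mxtrace !big_ord_recl !big_ord0 !mxE /=; split; field.
Qed.

(** * The scalar Riccati fixed point as a function of [g] *)

Lemma riccati_eq l g p : 0 <= g -> riccati l g p ->
  (1 - l ^+ 2) * p = 1 - g * (p * (p - 1)).
Proof.
move=> g0 [p1 /(congr1 ( *%R^~ (1 + g * p)))].
have d0 : 1 + g * p != 0 by apply: lt0r_neq0; nra.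
by rewrite /damp mulrDl -mulrA divfK // => pE; nra.
Qed.

Lemma sqr_norm_lt1 l : `|l| < 1 -> l ^+ 2 < 1.
Proof. by move=> l1; rewrite -real_normK ?num_real // expr_lt1. Qed.

Lemma riccati_ex l g : `|l| < 1 -> 0 <= g -> exists p, riccati l g p.
Proof.
move=> l1 g0.
have a0 : 0 <= l ^+ 2 by rewrite sqr_ge0.
have a1 := sqr_norm_lt1 _ l1.
pose P := (1 - l ^+ 2)^-1.
have PE : (1 - l ^+ 2) * P = 1 by rewrite divff // subr_eq0 gt_eqF.
have P1 : 1 <= P by rewrite invf_ge1; lra.
pose f : {poly R} := g *: 'X^2 + (1 - g - l ^+ 2) *: 'X - 1.
have fE x : f.[x] = g * x ^+ 2 + (1 - g - l ^+ 2) * x - 1 by rewrite !hornerE.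
(* [f] is the fixed-point equation cleared of its denominator: f(1) = - l^2 and f(P) = g P (P -
   1). *)
have [|p /andP[p1 _]] := @poly_ivt R f 1 P P1.
  have : 0 <= g * (P * (P - 1)) by rewrite !mulr_ge0 //; lra.
  by rewrite !fE expr1n => gP; apply/andP; split; nra.
rewrite /root fE => /eqP fp; exists p; split => //.
have d0 : 1 + g * p != 0 by apply: lt0r_neq0; nra.
by apply: (mulIf d0); rewrite /damp mulrDl -mulrA divfK //; nra.
Qed.

Lemma riccati_gt1 l g p : 0 < l ^+ 2 -> 0 <= g -> riccati l g p -> 1 < p.
Proof.
move=> a0 g0 [p1 ->]; rewrite ltrDl mulr_gt0 // divr_gt0; nra.
Qed.

(** If p' <= p, then g' p' (p' - 1) < g p (p - 1), and [riccati_eq] yields p < p', a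
    contradiction. *)
Lemma riccati_lt l g g' p p' : 0 < l ^+ 2 -> l ^+ 2 < 1 -> 0 <= g' -> g' < g ->
  riccati l g p -> riccati l g' p' -> p < p'.
Proof.
move=> a0 a1 g'0 gg' rp rp'; have g0 : 0 <= g by lra.
have := riccati_gt1 _ _ _ a0 g0 rp; have := riccati_gt1 _ _ _ a0 g'0 rp'.
have := riccati_eq _ _ _ g0 rp; have := riccati_eq _ _ _ g'0 rp'.
move=> e' e p'1 p1; rewrite ltNge; apply/negP => p'p.
have : 0 < p * (p - 1) by nra.
have : p' * (p' - 1) <= p * (p - 1) by nra.
by move=> *; nra.
Qed.

(** Eliminating [g] makes the posterior cost a function of [p] alone, so that comparisons and limits
    of [p] transfer to it. *)
Lemma riccati_post l g p : 0 < l ^+ 2 -> 0 <= g -> riccati l g p ->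
  (1 + g) * damp g p = 1 + (p - 1) ^+ 2 / (l ^+ 2 * p).
Proof.
move=> a0 g0 rp; have [p1 pE] := rp.
have uE : damp g p = (p - 1) / l ^+ 2 by rewrite {2}pE addrAC subrr add0r mulrC mulKf ?gt_eqF.
have gu : g * damp g p = 1 - damp g p / p.
  by rewrite /damp; field; apply/andP; split; apply: lt0r_neq0; nra.
have l0 : l != 0 by rewrite -sqrf_eq0 gt_eqF.
have p0 : p != 0 by apply: lt0r_neq0; lra.
by rewrite mulrDl mul1r gu uE; field; rewrite l0 p0.
Qed.

(** (p - 1)^2 / p = p - 2 + 1/p increases on [1, oo). *)
Lemma riccati_post_lt l p p' : 0 < l ^+ 2 -> 1 <= p -> p < p' ->
  (p - 1) ^+ 2 / (l ^+ 2 * p) < (p' - 1) ^+ 2 / (l ^+ 2 * p').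
Proof.
move=> a0 p1 pp'.
have l0 : l != 0 by rewrite -sqrf_eq0 gt_eqF.
have p0 : p != 0 by apply: lt0r_neq0; lra.
have p'0 : p' != 0 by apply: lt0r_neq0; lra.
rewrite -subr_gt0 (_ : _ - _ = (p' - p) * (p * p' - 1) / (l ^+ 2 * (p * p'))).
  have q1 : 0 < p * p' - 1 by rewrite subr_gt0; nra.
  apply: divr_gt0; apply: mulr_gt0 => //; first by rewrite subr_gt0.
  by nra.
by field; rewrite l0 p0 p'0.
Qed.

(** By [riccati_eq], P - p = P g p (p - 1) >= 0 with P the inverse of 1 - l^2; then p <= P bounds p
    (p - 1) by P^2. *)
Lemma riccati_prior_dist l g p : l ^+ 2 < 1 -> 0 <= g -> riccati l g p ->
  `|(1 - l ^+ 2)^-1 - p| <= (1 - l ^+ 2)^-1 ^+ 3 * g.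
Proof.
move=> a1 g0 rp; have [p1 _] := rp; have e := riccati_eq _ _ _ g0 rp.
have a0 : 0 <= l ^+ 2 by rewrite sqr_ge0.
set P := (_^-1).
have PE : (1 - l ^+ 2) * P = 1 by rewrite divff // subr_eq0 gt_eqF.
have P1 : 1 <= P by rewrite invf_ge1; lra.
have dE : P - p = P * (g * (p * (p - 1))).
  have -> : g * (p * (p - 1)) = 1 - (1 - l ^+ 2) * p by lra.
  by rewrite mulrBr mulr1 mulrA [P * _]mulrC PE mul1r.
have d0 : 0 <= P - p by rewrite dE !mulr_ge0 //; lra.
rewrite ger0_norm // dE (_ : P ^+ 3 * g = P * (g * (P * P))); last by ring.
by rewrite ler_wpM2l ?ler_wpM2l //; nra.
Qed.

(** The expression in [riccati_post] takes the value P at p = P, because P - 1 = l^2 P; the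
    difference is P - p times a factor in [0, 1 / l^2]. *)
Lemma riccati_post_dist l g p : 0 < l ^+ 2 -> l ^+ 2 < 1 -> 0 <= g ->
  riccati l g p ->
  `|(1 - l ^+ 2)^-1 - (1 + g) * damp g p| <=
     (1 - l ^+ 2)^-1 ^+ 3 / l ^+ 2 * g.
Proof.
move=> a0 a1 g0 rp; have [p1 _] := rp; rewrite (riccati_post _ _ _ a0 g0 rp).
have := riccati_prior_dist _ _ _ a1 g0 rp; set P := (_^-1) => dist.
have PE : (1 - l ^+ 2) * P = 1 by rewrite divff // subr_eq0 gt_eqF.
have P1 : 1 <= P by rewrite invf_ge1; lra.
have -> : P - (1 + (p - 1) ^+ 2 / (l ^+ 2 * p)) =
    (P - p) * ((1 - (p * P)^-1) / l ^+ 2).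
  rewrite /P; field.
  have l0 : l != 0 by rewrite -sqrf_eq0 gt_eqF.
  have p0 : p != 0 by apply: lt0r_neq0; lra.
  by rewrite l0 p0 andbT; apply: lt0r_neq0; lra.
have q1 : 1 <= p * P by nra.
have qV0 : 0 <= (p * P)^-1 by rewrite invr_ge0; lra.
have qV1 : (p * P)^-1 <= 1 by rewrite invf_le1; lra.
rewrite normrM mulrAC ler_pM // normrM [`|(_ ^-1)|]gtr0_norm ?invr_gt0 //.
move: (p * P)^-1 qV0 qV1 => q q0 q1'.
by rewrite ler_piMl ?invr_ge0 ?(ltW a0) // ger0_norm; lra.
Qed.

(** * Limits in [h], greedy selections and optimal values *)

Lemma cvg_inv_sqr (f : R -> R) (L K : R) : 0 <= K ->
  (forall h, 0 < h -> `|L - f h| <= K / h ^+ 2) -> f h @[h --> +oo] --> L.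
Proof.
move=> K0 dist; apply/cvgrPdist_le => e e0; near=> h.
have h1 : 1 < h by near: h; apply: nbhs_pinfty_gt; rewrite num_real.
have hK : K / e < h by near: h; apply: nbhs_pinfty_gt; rewrite num_real.
have h0 : 0 < h by lra.
apply: le_trans (dist h h0) _; rewrite ler_pdivrMr ?exprn_gt0 //.
by move: hK; rewrite ltr_pdivrMr // => hK; nra.
Unshelve. all: by end_near. Qed.

(** Strict inequality forces sensor 2 as first choice, without ties; the second choice is then
    sensor 1 or 3. *)
Lemma greedy_output_sensor2 (f : {set 'I_3} -> R) S :
  (forall T T' : {set 'I_3}, sensor2 \in T -> #|T| = 1%N ->
    sensor2 \notin T' -> #|T'| = 1%N -> f T < f T') ->
  greedy_output f 2 S -> sensor2 \in S /\ (sensor1 \in S) = (sensor3 \notin S).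
Proof.
move=> f2 gr; inversion gr as [|k T j gr1 [jT _]]; subst.
inversion gr1 as [|k T0 i gr0 [_ imin]]; subst.
inversion gr0; subst.
have i2 : i = sensor2.
  apply/eqP/negPn/negP => ni2.
  have := imin sensor2; rewrite inE => /(_ isT); apply/negP; rewrite -ltNge.
  by apply: f2; rewrite finset.setU0 ?cards1 // inE ?eqxx // eq_sym.
move: jT; rewrite i2 !inE orbF => j2.
by move: j j2 {gr}; apply: forall_sensor => // _; rewrite !inE.
Qed.

(** All singletons share the residual trace 1, so comparing them reduces to comparing [g]. *)
Lemma singleton_costs l h S : `|l| < 1 -> 0 < h -> #|S| = 1%N ->
  if sensor2 \in S then has_steady_costs l h S (h ^+ 2)^-1 1
  else exists2 g, 0 <= g < (h ^+ 2)^-1 & has_steady_costs l h S g 1.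
Proof.
move=> l1 h0 /eqP/cards1P[j ->].
have h2 : 0 < (h ^+ 2)^-1 by rewrite invr_gt0 exprn_gt0.
have h2E : (2 * h ^+ 2)^-1 = (h ^+ 2)^-1 / 2 by rewrite invfM mulrC.
move: j; apply: forall_sensor; rewrite inE /=.
- exists (2 * h ^+ 2)^-1; last by apply: costs_1; rewrite ?inE.
  by rewrite h2E; apply/andP; split; lra.
- by apply: costs_2; rewrite ?inE.
- by exists 0; [rewrite lexx | apply: costs_3; rewrite ?inE].
Qed.

Lemma pair_costs l h S : `|l| < 1 -> 0 < h ->
  sensor2 \in S -> (sensor1 \in S) = (sensor3 \notin S) ->
  exists2 g, 0 <= g <= 2 / h ^+ 2 & has_steady_costs l h S g 0.
Proof.
move=> l1 h0 S2 S13; have h2 : 0 < (h ^+ 2)^-1 by rewrite invr_gt0 exprn_gt0.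
case: (boolP (sensor3 \in S)) S13 => [S3 /= /negbT S1 | S3 S1].
  by exists (2 / h ^+ 2); [apply/andP; split; lra | exact: costs_23].
by exists (h ^+ 2)^-1; [apply/andP; split; lra | exact: costs_12].
Qed.

(** In the regular cases p >= 1 gives p + 2 >= 3, and [riccati_post] gives 1 plus a nonnegative
    term; sensors 1 and 3 together attain both bounds. *)
Lemma costs_lower_bound l h S : 0 < l ^+ 2 -> `|l| < 1 -> 0 < h -> (#|S| <= 2)%N ->
  3 <= prior_cost l h S /\ 1 <= post_cost l h S.
Proof.
move=> a0 l1 h0 cardS.
have regular g c : 0 <= g -> 0 <= c -> has_steady_costs l h S g c ->
    3 <= prior_cost l h S /\ 1 <= post_cost l h S.
  move=> g0 c0; have [p rp] := riccati_ex _ _ l1 g0.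
  move=> /(_ _ rp)[-> ->]; rewrite (riccati_post _ _ _ a0 g0 rp); have [p1 _] := rp.
  have : 0 <= (p - 1) ^+ 2 / (l ^+ 2 * p).
    by rewrite divr_ge0 ?sqr_ge0 // mulr_ge0 ?ltW //; lra.
  by split; lra.
have h2 : 0 < (h ^+ 2)^-1 by rewrite invr_gt0 exprn_gt0.
case: (boolP (sensor1 \in S)) => S1; case: (boolP (sensor2 \in S)) => S2;
  case: (boolP (sensor3 \in S)) => S3.
- suff ST : S = [set: 'I_3]%SET by move: cardS; rewrite ST cardsT card_ord.
  by apply/setP; apply: forall_sensor; rewrite !inE.
- by apply: regular (costs_12 _ _ _ l1 h0 S1 S2 S3); lra.
- by have [-> ->] := costs_13 _ h _ l1 S1 S2 S3.
- by apply: regular (costs_1 _ _ _ l1 h0 S1 S2 S3) => //; rewrite invr_ge0 mulr_ge0 ?sqr_ge0.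
- by apply: regular (costs_23 _ _ _ l1 h0 S1 S2 S3); lra.
- by apply: regular (costs_2 _ _ _ l1 h0 S1 S2 S3); lra.
- by apply: regular (costs_3 _ h _ l1 S1 S2 S3).
- by apply: regular (costs_none _ h _ l1 S1 S2 S3).
Qed.

Lemma singleton_cost_lt l h S (T : {set 'I_3}) : 0 < l ^+ 2 -> `|l| < 1 -> 0 < h ->
  sensor2 \in S -> #|S| = 1%N -> sensor2 \notin T -> #|T| = 1%N ->
  prior_cost l h S < prior_cost l h T /\ post_cost l h S < post_cost l h T.
Proof.
move=> a0 l1 h0 S2 S1 /negbTE T2 T1.
have h2 : 0 <= (h ^+ 2)^-1 by rewrite invr_ge0 sqr_ge0.
have := singleton_costs l h S l1 h0 S1; rewrite S2 => costS.
have := singleton_costs l h T l1 h0 T1; rewrite T2 => -[g /andP[g0 gh] costT].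
have [p rp] := riccati_ex _ _ l1 h2; have [p' rp'] := riccati_ex _ _ l1 g0.
have [-> ->] := costS _ rp; have [-> ->] := costT _ rp'.
have pp' := riccati_lt _ _ _ _ _ a0 (sqr_norm_lt1 _ l1) g0 gh rp rp'.
rewrite (riccati_post _ _ _ a0 h2 rp) (riccati_post _ _ _ a0 g0 rp').
have := riccati_post_lt _ _ _ a0 rp.1 pp'.
by split; lra.
Qed.

Lemma optimal_costs l h S (f := prior_cost l h) (g := post_cost l h) :
  0 < l ^+ 2 -> `|l| < 1 -> 0 < h ->
  (kfss_optimal f 2 S -> f S = 3) /\ (kfss_optimal g 2 S -> g S = 1).
Proof.
move=> a0 l1 h0; pose T : {set 'I_3} := (sensor1 |: [set sensor3])%SET.
have [fT gT] : f T = 3 /\ g T = 1 by apply: costs_13; rewrite // !inE.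
have cardT : (#|T| <= 2)%N by rewrite cardsU1 cards1 addn1 ltnS leq_b1.
split=> -[cardS /(_ _ cardT)]; rewrite ?fT ?gT => le; apply/eqP;
  by rewrite eq_le le; have [] := costs_lower_bound _ _ _ a0 l1 h0 cardS.
Qed.

End Instance3.

Theorem theorem3 (R : realType) (lambda1 : R)
  (hl0 : 0 < `|lambda1|) (hl1 : `|lambda1| < 1) :
  (forall Sgre Sopt : R -> {set 'I_3},
     (forall h : R, 0 < h ->
        greedy_output (prior_cost lambda1 h) 2 (Sgre h)) ->
     (forall h : R, 0 < h ->
        kfss_optimal (prior_cost lambda1 h) 2 (Sopt h)) ->
     prior_cost lambda1 h (Sgre h) / prior_cost lambda1 h (Sopt h)
       @[h --> +oo] --> (2 / 3 + 1 / (3 * (1 - lambda1 ^+ 2)) : R))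
  /\
  (forall Sgre Sopt : R -> {set 'I_3},
     (forall h : R, 0 < h ->
        greedy_output (post_cost lambda1 h) 2 (Sgre h)) ->
     (forall h : R, 0 < h ->
        kfss_optimal (post_cost lambda1 h) 2 (Sopt h)) ->
     post_cost lambda1 h (Sgre h) / post_cost lambda1 h (Sopt h)
       @[h --> +oo] --> (1 / (1 - lambda1 ^+ 2) : R)).
Proof.
have a0 : 0 < lambda1 ^+ 2 by rewrite -real_normK ?num_real // exprn_gt0.
have a1 := sqr_norm_lt1 _ hl1.
set P := (1 - lambda1 ^+ 2)^-1.
have P0 : 0 < P by rewrite invr_gt0 subr_gt0.
have P3 : 0 <= P ^+ 3 by rewrite exprn_ge0 // ltW.
have K0 : 0 <= P ^+ 3 / lambda1 ^+ 2 by rewrite divr_ge0 // ltW.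
split=> Sgre Sopt gre opt.
(* The factor 2 comes from g <= 2 / h^2 in [pair_costs]. *)
- apply: (@cvg_inv_sqr _ _ _ (P ^+ 3 * 2)) => [|h h0].
    by rewrite mulr_ge0.
  have [S2 S13] : sensor2 \in Sgre h /\ (sensor1 \in Sgre h) = (sensor3 \notin Sgre h).
    apply: greedy_output_sensor2 (gre h h0) => T T' T2 T1 T'2 T'1.
    by have [] := singleton_cost_lt _ _ _ _ a0 hl1 h0 T2 T1 T'2 T'1.
  have [g /andP[g0 gh] costS] := pair_costs _ _ _ hl1 h0 S2 S13.
  have [p rp] := riccati_ex _ _ hl1 g0; have [-> _] := costS _ rp.
  have [/(_ (opt h h0)) -> _] := optimal_costs _ _ (Sopt h) a0 hl1 h0.
  (* The claimed limit is (P + 2) / 3, the ratio with [p] replaced by P. *)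
  have -> : 2 / 3 + 1 / (3 * (1 - lambda1 ^+ 2)) - (p + 2) / 3 = (P - p) / 3.
    by rewrite /P; field; apply: lt0r_neq0; lra.
  rewrite normrM [`|3^-1|]ger0_norm ?invr_ge0 //.
  apply: (@le_trans _ _ `|P - p|); first by rewrite ler_piMr // invf_le1; lra.
  apply: le_trans (riccati_prior_dist _ _ _ a1 g0 rp) _.
  by rewrite -[X in _ <= X]mulrA ler_wpM2l.
- apply: (@cvg_inv_sqr _ _ _ (P ^+ 3 / lambda1 ^+ 2 * 2)) => [|h h0].
    by rewrite mulr_ge0.
  have [S2 S13] : sensor2 \in Sgre h /\ (sensor1 \in Sgre h) = (sensor3 \notin Sgre h).
    apply: greedy_output_sensor2 (gre h h0) => T T' T2 T1 T'2 T'1.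
    by have [] := singleton_cost_lt _ _ _ _ a0 hl1 h0 T2 T1 T'2 T'1.
  have [g /andP[g0 gh] costS] := pair_costs _ _ _ hl1 h0 S2 S13.
  have [p rp] := riccati_ex _ _ hl1 g0; have [_ ->] := costS _ rp.
  have [_ /(_ (opt h h0)) ->] := optimal_costs _ _ (Sopt h) a0 hl1 h0.
  rewrite divr1 div1r addr0.
  apply: le_trans (riccati_post_dist _ _ _ a0 a1 g0 rp) _.
  by rewrite -[X in _ <= X]mulrA ler_wpM2l.
Qed.
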